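(* Let $n\ge 1$. There is a unique non-zero element $f\in VTL_n(d)$ such that (i) $f^2=f$; (ii) $fe_i=e_if=0$ for $i=1,2,\dots,n-1$; (iii) $fv_i=v_if=f$ for $i=1,2,\dots,n-1$.
   Context: Let $d$ be an indeterminate and $K=\mathbb{C}(d)$. The virtual Temperley-Lieb algebra $VTL_n(d)$ is the unital associative $K$-algebra (isomorphic to the Brauer algebra with parameter $d$) with $K$-basis the set of all $(2n-1)!!$ diagrams (''connection elements''), i.e. perfect matchings of $2n$ points consisting of $n$ top points $1,\dots,n$ and $n$ bottom points $1,\dots,n$. The product $XY$ of diagrams is obtained by stacking $X$ above $Y$, identifying the bottom points of $X$ with the top points of $Y$, replacing each closed loop formed by a factor $d$; crossings of arcs carry no information. The identity $1_n$ joins top $j$ to bottom $j$ for all $j$. For $1\le i\le n-1$: $e_i$ joins top $i$ to top $i+1$, bottom $i$ to bottom $i+1$, and top $j$ to bottom $j$ for $j\ne i,i+1$; $v_i$ joins top $i$ to bottom $i+1$, top $i+1$ to bottom $i$, and top $j$ to bottom $j$ for $j\ne i,i+1$. *)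

(* Defs.v *)
From HB Require Import structures.
From mathcomp Require Import all_boot all_order all_algebra.
From mathcomp Require Import complex reals.

Set Implicit Arguments.
Unset Strict Implicit.
Unset Printing Implicit Defensive.

Import GRing.Theory.

Local Open Scope ring_scope.

(* [inl i] is the i-th top point and [inr i] the i-th bottom point; points are
   numbered from 0. *)
Definition point (n : nat) : Type := ('I_n + 'I_n)%type.

HB.instance Definition _ n := Finite.copy (point n) ('I_n + 'I_n)%type.

(* A perfect matching is encoded by the map sending each point to the point it
   is joined to, that is, by a fixed-point free involution. *)
Definition is_matching n (s : {ffun point n -> point n}) : bool :=
  [forall p, (s (s p) == p) && (s p != p)].

Record diagram (n : nat) := Diagram {
  partner :> {ffun point n -> point n};
  partner_matching : is_matching partner
}.

HB.instance Definition _ n := [isSub for @partner n].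
HB.instance Definition _ n := [Finite of diagram n by <:].

Lemma partnerK n (X : diagram n) : involutive X.
Proof. by move=> p; case/andP: (forallP (partner_matching X) p) => /eqP. Qed.

Lemma partner_neq n (X : diagram n) p : X p != p.
Proof. by case/andP: (forallP (partner_matching X) p). Qed.

(* Stacking X above Y: [inl (inl i)], [inl (inr i)] and [inr i] are the i-th
   points of the top, middle and bottom rows. The middle row consists of the
   bottom points of X, identified with the top points of Y. *)
Definition vertex (n : nat) : Type := ('I_n + 'I_n + 'I_n)%type.

HB.instance Definition _ n := Finite.copy (vertex n) ('I_n + 'I_n + 'I_n)%type.

Definition upper n (p : point n) : vertex n :=
  match p with inl i => inl (inl i) | inr i => inl (inr i) end.

Definition lower n (p : point n) : vertex n :=
  match p with inl i => inl (inr i) | inr i => inr i end.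

Definition outer n (p : point n) : vertex n :=
  match p with inl i => inl (inl i) | inr i => inr i end.

Definition stack_adj n (X Y : diagram n) : rel (vertex n) := fun u v =>
  [exists p, (u == upper p) && (v == upper (X p))]
  || [exists p, (u == lower p) && (v == lower (Y p))].

(* The closed loops are the connected components of the stacked graph that
   avoid the top and bottom rows. *)
Definition loops n (X Y : diagram n) : nat :=
  n_comp (stack_adj X Y)
    [pred u | [forall p, ~~ connect (stack_adj X Y) u (outer p)]].

Section DihedralOrbit.

Variables (V : finType) (a b : V -> V) (e : rel V).
Hypotheses (aK : involutive a) (bK : involutive b).
Hypothesis fixN : forall u, a u = u -> b u <> u.
Hypothesis e_ab : forall u v, e u v -> v = a u \/ v = b u.
Hypothesis e_a : forall u, connect e u (a u).
Hypothesis e_b : forall u, connect e u (b u).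

Lemma dihedral_ends x : b x = x ->
  exists y, [/\ y != x, connect e x y, a y = y \/ b y = y &
    forall z, connect e x z -> a z = z \/ b z = z -> z = x \/ z = y].
Proof.
move=> bx; pose g u := b (a u); pose N := order g x.
have g_inj : injective g by move=> u v /(inv_inj bK)/(inv_inj aK).
have iterN : iter N g x = x by apply: iter_order.
have N_gt0 : (0 < N)%N by apply: order_gt0.
have it_inj j k : (j < N)%N -> (k < N)%N -> iter j g x = iter k g x -> j = k.
  move=> jN kN jk.
  by rewrite -(findex_iter jN) jk findex_iter.
have aE m k : (k + m).+1 = N -> a (iter k g x) = iter m g x.
  elim: m k => [|m IH] k km.
    rewrite addn0 in km; rewrite /= -[LHS]bK.
    by rewrite -[b (a _)]/(iter k.+1 g x) km iterN.
  rewrite -[LHS]bK -[b (a _)]/(iter k.+1 g x) -[iter k.+1 g x]aK.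
  by rewrite (IH k.+1) // -km addnS.
have bE m k : (k + m)%N = N -> b (iter k g x) = iter m g x.
  case: k => [|k] km; first by rewrite add0n in km; rewrite /= bx km iterN.
  rewrite -[iter k.+1 g x]/(b (a (iter k g x))) bK; apply: aE.
  by rewrite -km addSn.
have con k : connect e x (iter k g x).
  elim: k => [|k IH] /=; first exact: connect0.
  by apply: connect_trans IH _; apply: connect_trans (e_a _) (e_b _).
have orb z : connect e x z -> exists2 k, (k < N)%N & z = iter k g x.
  case/connectP=> p; elim/last_ind: p z => [|p w IH] z.
    by move=> _ ->; exists 0%N.
  rewrite rcons_path last_rcons => /andP[xp ew] ->.
  have [k kN lE] := IH _ xp erefl.
  rewrite lE in ew; case: (e_ab ew) => ->.
    exists (N - k.+1)%N; first by rewrite ltn_subrL N_gt0.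
    by apply: aE; rewrite -addSn subnKC.
  case: k kN {lE ew} => [|k] kN; first by exists 0%N.
  exists (N - k.+1)%N; first by rewrite ltn_subrL N_gt0.
  by apply: bE; rewrite subnKC // ltnW.
have ends k : (k < N)%N -> a (iter k g x) = iter k g x
    \/ b (iter k g x) = iter k g x -> k = 0%N \/ k = N./2.
  move=> kN [].
    rewrite (aE (N - k.+1)%N); last by rewrite -addSn subnKC.
    move/it_inj => kE; right.
    have {}kE : (N - k.+1)%N = k by apply: kE => //; rewrite ltn_subrL N_gt0.
    have <- : (k.+1 + k)%N = N by rewrite -[in X in (_ + X)%N]kE subnKC.
    by rewrite addSn addnn /= uphalf_double.
  case: k kN => [|k] kN; first by left.
  rewrite (bE (N - k.+1)%N); last by rewrite subnKC // ltnW.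
  move/it_inj => kE; right.
  have {}kE : (N - k.+1)%N = k.+1 by apply: kE => //; rewrite ltn_subrL N_gt0.
  have <- : (k.+1 + k.+1)%N = N by rewrite -[in X in (_ + X)%N]kE subnKC // ltnW.
  by rewrite addnn doubleK.
have hN : (N./2 < N)%N by rewrite -divn2 ltn_Pdiv.
have fixy : a (iter N./2 g x) = iter N./2 g x
    \/ b (iter N./2 g x) = iter N./2 g x.
  case: (boolP (odd N)) => oN; [left; apply: aE | right; apply: bE].
    by rewrite addnn -[RHS]odd_double_half oN.
  by rewrite addnn -[RHS]odd_double_half (negbTE oN).
exists (iter N./2 g x); split => //.
  apply/eqP => yx.
  have h0 : N./2 = 0%N by apply: it_inj.
  have N1 : N = 1%N.
    by move: N_gt0; rewrite -(odd_double_half N) h0; case: odd.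
  by apply: (fixN _ bx); apply: (aE 0%N 0%N).
move=> z /orb[k kN ->] /(ends k kN)[->|->]; by [left|right].
Qed.

End DihedralOrbit.

Section StackEnds.

Variables (n : nat) (X Y : diagram n).

Let up (u : vertex n) : vertex n :=
  match u with
  | inl (inl i) => upper (X (inl i))
  | inl (inr i) => upper (X (inr i))
  | inr _ => u
  end.

Let lo (u : vertex n) : vertex n :=
  match u with
  | inl (inl _) => u
  | inl (inr i) => lower (Y (inl i))
  | inr i => lower (Y (inr i))
  end.

Let up_upper p : up (upper p) = upper (X p). Proof. by case: p. Qed.
Let lo_lower p : lo (lower p) = lower (Y p). Proof. by case: p. Qed.

Lemma upper_inj : injective (@upper n).
Proof. by move=> [i|i] [j|j] //= [->]. Qed.

Lemma lower_inj : injective (@lower n).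
Proof. by move=> [i|i] [j|j] //= [->]. Qed.

Lemma outer_inj : injective (@outer n).
Proof. by move=> [i|i] [j|j] //= [->]. Qed.

Let upK : involutive up.
Proof.
by move=> [[i|i]|i] //; [rewrite -[inl (inl i)]/(upper (inl i))
  | rewrite -[inl (inr i)]/(upper (inr i))]; rewrite !up_upper partnerK.
Qed.

Let loK : involutive lo.
Proof.
by move=> [[i|i]|i] //; [rewrite -[inl (inr i)]/(lower (inl i))
  | rewrite -[inr i]/(lower (inr i))]; rewrite !lo_lower partnerK.
Qed.

Let up_neq p : up (upper p) <> upper p.
Proof. by rewrite up_upper => /upper_inj/eqP; rewrite (negbTE (partner_neq _ _)). Qed.

Let lo_neq p : lo (lower p) <> lower p.
Proof. by rewrite lo_lower => /lower_inj/eqP; rewrite (negbTE (partner_neq _ _)). Qed.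

Let fix_up u : up u = u -> lo u <> u.
Proof.
case: u => [[i|i]|i]; first by move/(@up_neq (inl i)).
  by move/(@up_neq (inr i)).
by move=> _; apply: (@lo_neq (inr i)).
Qed.

Let outer_fix p : up (outer p) = outer p \/ lo (outer p) = outer p.
Proof. by case: p => i; [right|left]. Qed.

Let fix_outer u : up u = u \/ lo u = u -> exists p, u = outer p.
Proof.
case: u => [[i|i]|i]; [by exists (inl i) | | by exists (inr i)].
by case=> [/(@up_neq (inr i))|/(@lo_neq (inl i))].
Qed.

Let adj_ab u v : stack_adj X Y u v -> v = up u \/ v = lo u.
Proof.
case/orP=> /existsP[p /andP[/eqP-> /eqP->]].
  by left; rewrite up_upper.
by right; rewrite lo_lower.
Qed.

Let adj_up u : connect (stack_adj X Y) u (up u).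
Proof.
have H p : connect (stack_adj X Y) (upper p) (up (upper p)).
  apply: connect1; apply/orP; left; apply/existsP; exists p.
  by rewrite up_upper !eqxx.
case: u => [[i|i]|i]; [exact: (H (inl i))|exact: (H (inr i))|].
exact: connect0.
Qed.

Let adj_lo u : connect (stack_adj X Y) u (lo u).
Proof.
have H p : connect (stack_adj X Y) (lower p) (lo (lower p)).
  apply: connect1; apply/orP; right; apply/existsP; exists p.
  by rewrite lo_lower !eqxx.
case: u => [[i|i]|i]; [|exact: (H (inl i))|exact: (H (inr i))].
exact: connect0.
Qed.

Lemma stack_adj_sym : symmetric (stack_adj X Y).
Proof.
suff H u v : stack_adj X Y u v -> stack_adj X Y v u by move=> u v; apply/idP/idP; apply: H.
case/orP=> /existsP[p /andP[/eqP-> /eqP->]]; apply/orP;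
  [left; apply/existsP; exists (X p) | right; apply/existsP; exists (Y p)];
  by rewrite partnerK !eqxx.
Qed.

(* Each component meeting the top or bottom row meets it in exactly two points. *)
Lemma stack_ends p : exists q, [/\ q != p,
  connect (stack_adj X Y) (outer p) (outer q) &
  forall r, connect (stack_adj X Y) (outer p) (outer r) -> r = p \/ r = q].
Proof.
have [y [yp cy fy uy]] : exists y, [/\ y != outer p,
    connect (stack_adj X Y) (outer p) y, up y = y \/ lo y = y &
    forall z, connect (stack_adj X Y) (outer p) z -> up z = z \/ lo z = z ->
      z = outer p \/ z = y].
  case: p => i; first exact: (dihedral_ends upK loK fix_up adj_ab adj_up adj_lo).
  have fix_lo u : lo u = u -> up u <> u by move=> lu /fix_up.
  have adj_ba u v : stack_adj X Y u v -> v = lo u \/ v = up u.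
    by case/adj_ab; [right|left].
  have [y [yp cy fy uy]] := dihedral_ends loK upK fix_lo adj_ba adj_lo adj_up
    (erefl : up (outer (inr i)) = outer (inr i)).
  exists y; split => //; first by case: fy; [right|left].
  by move=> z cz fz; apply: uy => //; case: fz; [right|left].
have [q yE] := fix_outer fy; subst y.
exists q; split => //; first by apply: contra_neq yp => ->.
move=> r cr; case: (uy _ cr (outer_fix r)) => /outer_inj; by [left|right].
Qed.

Definition comp_fun : {ffun point n -> point n} :=
  [ffun p => odflt p
     [pick q | (q != p) && connect (stack_adj X Y) (outer p) (outer q)]].

Lemma comp_funP p : (comp_fun p != p) /\
  forall q, connect (stack_adj X Y) (outer p) (outer q) = (q == p) || (q == comp_fun p).
Proof.
have [r [rp cr ur]] := stack_ends p.
rewrite ffunE; case: pickP => [s /andP[sp cs]|/(_ r)]; last by rewrite rp cr.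
split=> // q; apply/idP/orP => [/ur|]; last first.
  by case=> /eqP->; [exact: connect0|].
case: (ur _ cs) => [sE|->]; first by rewrite sE eqxx in sp.
by case=> ->; [left|right].
Qed.

Lemma comp_matching : is_matching comp_fun.
Proof.
apply/forallP => p; have [np pE] := comp_funP p.
rewrite np andbT; set q := comp_fun p in np pE *.
have [nq qE] := comp_funP q.
have : connect (stack_adj X Y) (outer q) (outer p).
  by rewrite (sym_connect_sym stack_adj_sym) pE eqxx orbT.
by rewrite qE eq_sym (negbTE np) /= eq_sym.
Qed.

(* The diagram obtained by stacking X above Y, with closed loops discarded. *)
Definition comp : diagram n := Diagram comp_matching.

End StackEnds.

Section Generators.

Variables (n : nat) (i : 'I_n.-1).

Lemma gen_ltS : (i.+1 < n)%N. Proof. by rewrite -ltn_predRL. Qed.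

Let l : 'I_n := Ordinal (ltnW gen_ltS).
Let r : 'I_n := Ordinal gen_ltS.

Definition e_fun : {ffun point n -> point n} :=
  [ffun p : point n => match p with
     | inl j => if j == l then inl r else if j == r then inl l else inr j
     | inr j => if j == l then inr r else if j == r then inr l else inl j
     end].

Definition v_fun : {ffun point n -> point n} :=
  [ffun p : point n => match p with
     | inl j => if j == l then inr r else if j == r then inr l else inr j
     | inr j => if j == l then inl r else if j == r then inl l else inl j
     end].

Let r_neq_l : (r == l) = false.
Proof. by rewrite -val_eqE /= eqn_leq ltnn. Qed.

Lemma e_matching : is_matching e_fun.
Proof.
apply/forallP => -[j|j]; rewrite !ffunE.
all: have [jl|/negbTE jl] := eqVneq j l.
all: try by rewrite jl r_neq_l !eqxx; apply/eqP => -[/esym/n_Sn].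
all: have [jr|/negbTE jr] := eqVneq j r.
all: try by rewrite jr !eqxx; apply/eqP => -[/n_Sn].
all: by rewrite jl jr eqxx.
Qed.

Lemma v_matching : is_matching v_fun.
Proof.
apply/forallP => -[j|j]; rewrite !ffunE.
all: have [jl|/negbTE jl] := eqVneq j l.
all: try by rewrite jl r_neq_l !eqxx.
all: have [jr|/negbTE jr] := eqVneq j r.
all: try by rewrite jr !eqxx.
all: by rewrite jl jr eqxx.
Qed.

Definition e_diag : diagram n := Diagram e_matching.
Definition v_diag : diagram n := Diagram v_matching.

End Generators.

Section Algebra.

Variable R : realType.

(* C(d), with C = R[i]. *)
Definition K : fieldType := {fraction {poly R[i]}}.

Definition d : K := tofrac ('X : {poly R[i]}).

Variable n : nat.

Definition VTL : Type := {ffun diagram n -> K^o}.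

HB.instance Definition _ :=
  GRing.Lmodule.copy VTL {ffun diagram n -> K^o}.

Definition vtl_diag (X : diagram n) : VTL := [ffun Z => (Z == X)%:R].

(* The bilinear extension of X Y = d ^ (loops X Y) (comp X Y). *)
Definition vtl_mul (f g : VTL) : VTL :=
  \sum_(X : diagram n) \sum_(Y : diagram n)
     (f X * g Y * d ^+ loops X Y) *: vtl_diag (comp X Y).

Definition vtl_e (i : 'I_n.-1) : VTL := vtl_diag (e_diag i).
Definition vtl_v (i : 'I_n.-1) : VTL := vtl_diag (v_diag i).

End Algebra.

(* Main.v *)
Require Import Defs.
From mathcomp Require Import all_boot all_order all_algebra.
From mathcomp Require Import complex reals.
From mathcomp Require Import all_fingroup.
From mathcomp Require Import ring.

(** The product of a diagram [X] with [f] depends on [f] only through the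
    products with generators: if the [e_i] kill [f] and the [v_i] fix it, then
    [X f = f] when all arcs of [X] are through arcs, while [X f = 0] otherwise,
    because a bottom arc of [X] caps off two top points of [f] and invariance
    under permutations moves that cap to an [e_i]. So [g f] is [f] times the sum
    [s g] of the coefficients of [g] on permutations, and [s g = 1] when [g] is
    a nonzero idempotent solution. Two solutions thus satisfy [g f = f], and
    reflecting in a horizontal line, which reverses products and preserves
    solutions, gives [g f = g] as well.

    For existence, take the coefficient of a diagram to depend only on its number
    [t] of bottom points lying on bottom arcs. A cap kills the sum if and only if
    [(d + 2n - 2 - t) c_t + t c_(t-2) = 0], and this recursion can be solved since
    [d] is transcendental. *)

Set Implicit Arguments.
Unset Strict Implicit.
Unset Printing Implicit Defensive.

(* [comp] must mean composition of diagrams, not [ssrfun.comp]. *)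
Import GRing.Theory Num.Theory Defs.

Local Open Scope ring_scope.

(** * Relabelling and stacking diagrams *)

Lemma connect_map (T T' : finType) (e : rel T) (e' : rel T') (h : T -> T') :
    (forall u v, e u v -> connect e' (h u) (h v)) ->
  forall u v, connect e u v -> connect e' (h u) (h v).
Proof.
move=> he u v /connectP[p]; elim: p u => [|w p IH] u /=; first by move=> _ ->.
by case/andP=> /he uw wp vE; apply: connect_trans uw (IH _ wp vE).
Qed.

Section Relabel.

Variable n : nat.
Implicit Types (s t : {perm point n}) (D X Y Z : diagram n) (p q a b : point n).

Lemma diagramP X Y : X =1 Y -> X = Y.
Proof. by move=> XY; apply/val_inj/ffunP. Qed.

Lemma relabel_matching s D :
  is_matching [ffun p => s (D ((s^-1)%g p))].
Proof.
apply/forallP => p; rewrite !ffunE permK partnerK permKV eqxx /=.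
rewrite -(inj_eq (@perm_inj _ (s^-1)%g)) permK; exact: partner_neq.
Qed.

Definition relabel s D : diagram n := Diagram (relabel_matching s D).

Lemma relabelE s D p : relabel s D (s p) = s (D p).
Proof. by rewrite /= ffunE permK. Qed.

Lemma relabelP s D Y : (forall p, Y (s p) = s (D p)) -> relabel s D = Y.
Proof. by move=> YE; apply: diagramP => p; rewrite -(permKV s p) relabelE YE. Qed.

Lemma relabel1 D : relabel 1%g D = D.
Proof. by apply: relabelP => p; rewrite !perm1. Qed.

Lemma relabelM s t D : relabel (s * t)%g D = relabel t (relabel s D).
Proof. by apply: relabelP => p; rewrite !permM !relabelE. Qed.

Lemma relabelK s : cancel (relabel s) (relabel s^-1%g).
Proof. by move=> D; rewrite -relabelM mulgV relabel1. Qed.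

Lemma relabelVK s : cancel (relabel s^-1%g) (relabel s).
Proof. by move=> D; rewrite -relabelM mulVg relabel1. Qed.

Lemma relabel_inj s : injective (relabel s).
Proof. exact: can_inj (relabelK s). Qed.

(* Multiplication by the diagram with arcs [a b] and [a' b'] replaces the arcs
   [a p] and [b q] of [D] by [a b] and [p q]; exchanging [b] and [p] does this. *)
Definition splice a b D : diagram n := relabel (tperm b (D a)) D.

Lemma splice_id a b D : D a = b -> splice a b D = D.
Proof. by rewrite /splice => ->; rewrite tperm1 relabel1. Qed.

Lemma spliceK a b D : relabel (tperm b (D a)) (splice a b D) = D.
Proof. by rewrite /splice -relabelM tperm2 relabel1. Qed.

Lemma splice_l a b D : a != b -> splice a b D a = b.
Proof.
move=> ab; have := relabelE (tperm b (D a)) D a.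
by rewrite tpermR tpermD ?partner_neq // eq_sym.
Qed.

Lemma splice_far a b D p : p != a -> p != b -> D p != a -> D p != b ->
  splice a b D p = D p.
Proof.
move=> pa pb Dpa Dpb; have := relabelE (tperm b (D a)) D p.
have pDa : D a != p by apply: contra_neq Dpa => <-; rewrite partnerK.
have ap : D a != D p by rewrite (inj_eq (inv_inj (@partnerK n D))) eq_sym.
by rewrite !tpermD // eq_sym.
Qed.

Lemma splice_partner a b D : a != b -> D a != b ->
  splice a b D (D a) = D b.
Proof.
move=> ab Dab; have := relabelE (tperm b (D a)) D b.
rewrite tpermL tpermD //; first by rewrite eq_sym partner_neq.
by rewrite (inj_eq (inv_inj (@partnerK n D))).
Qed.

Lemma splice_relabel s a b D :
  splice (s a) (s b) (relabel s D) = relabel s (splice a b D).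
Proof.
by rewrite /splice relabelE -!relabelM -tpermJ /conjg !mulgA mulgV mul1g.
Qed.

Lemma top_fun_inj (s : 'S_n) :
  injective (fun p : point n => match p with inl i => inl (s i) | inr i => inr i end).
Proof. by move=> [i|i] [j|j] // [/perm_inj->]. Qed.

Definition top_perm (s : 'S_n) : {perm point n} := perm (@top_fun_inj s).

Lemma top_perml (s : 'S_n) i : top_perm s (inl i) = inl (s i).
Proof. by rewrite permE. Qed.

Lemma top_permr (s : 'S_n) i : top_perm s (inr i) = inr i.
Proof. by rewrite permE. Qed.

Lemma top_perm1 : top_perm 1%g = 1%g.
Proof. by apply/permP => -[i|i]; rewrite permE !perm1. Qed.

Lemma top_permM (s t : 'S_n) : top_perm (s * t)%g = (top_perm s * top_perm t)%g.
Proof. by apply/permP => -[i|i]; rewrite permM !permE ?permM. Qed.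

End Relabel.

(** * Connectivity and closed loops in stacked diagrams *)

Section Stack.

Variables (n : nat).
Implicit Types (D X Y Z : diagram n) (p q : point n) (u v : vertex n).

Lemma stack_sym X Y : connect_sym (stack_adj X Y).
Proof. exact/sym_connect_sym/stack_adj_sym. Qed.

Lemma stack_upper X Y p : connect (stack_adj X Y) (upper p) (upper (X p)).
Proof. by apply/connect1/orP; left; apply/existsP; exists p; rewrite !eqxx. Qed.

Lemma stack_lower X Y p : connect (stack_adj X Y) (lower p) (lower (Y p)).
Proof. by apply/connect1/orP; right; apply/existsP; exists p; rewrite !eqxx. Qed.

Lemma stack_adjP X Y u v : stack_adj X Y u v ->
  (exists2 p, u = upper p & v = upper (X p)) \/
  (exists2 p, u = lower p & v = lower (Y p)).
Proof.
by case/orP=> /existsP[p /andP[/eqP-> /eqP->]]; [left|right]; exists p.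
Qed.

(** A component through an outer point contains exactly one other outer point, so a single
    connection from each outer point determines the composite. *)
Lemma comp_eqP X Y Z :
  (forall p, connect (stack_adj X Y) (outer p) (outer (Z p))) -> comp X Y = Z.
Proof.
move=> XYZ; apply: diagramP => p; have [_ pE] := comp_funP X Y p.
by have := XYZ p; rewrite pE (negbTE (partner_neq _ _)) /= => /eqP.
Qed.

Lemma eq_comp X Y X' Y' :
    (forall p q, connect (stack_adj X Y) (outer p) (outer q) =
                 connect (stack_adj X' Y') (outer p) (outer q)) ->
  comp X Y = comp X' Y'.
Proof.
move=> eqXY; apply: comp_eqP => p; rewrite eqXY.
by have [_ ->] := comp_funP X' Y' p; rewrite eqxx orbT.
Qed.

Definition floating X Y : pred (vertex n) :=
  [pred u | [forall p, ~~ connect (stack_adj X Y) u (outer p)]].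

Lemma floating_closed X Y : closed (stack_adj X Y) (floating X Y).
Proof.
move=> u v uv; rewrite !inE; apply: eq_forallb => p.
by rewrite (same_connect (@stack_sym X Y) (connect1 uv)).
Qed.

Lemma loops0 X Y :
  (forall u, exists p, connect (stack_adj X Y) u (outer p)) -> loops X Y = 0%N.
Proof.
move=> up; apply: eq_card0 => u; rewrite !inE.
apply/negbTE/nandP; right; rewrite negb_forall; apply/existsP.
by have [p ?] := up u; exists p; rewrite negbK.
Qed.

Section Through.

Variables (X : diagram n) (s : 'S_n).
Hypothesis Xs : forall j, X (inr j) = inl (s j).

(** The arcs of [X] merely prolong those of [D] to the outer rows, so stacking relabels the top
    points of [D] by [s] and closes no loop. *)
Lemma through_connect D p :
  connect (stack_adj X D) (outer (top_perm s p)) (lower p).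
Proof.
case: p => j; last by rewrite top_permr.
by rewrite top_perml stack_sym; have := stack_upper X D (inr j); rewrite Xs.
Qed.

Lemma comp_through D : comp X D = relabel (top_perm s) D.
Proof.
apply: comp_eqP => p; rewrite -(permKV (top_perm s) p); set q := ((top_perm s)^-1)%g p.
rewrite relabelE; apply: connect_trans (through_connect D q) _.
by apply: connect_trans (stack_lower X D q) _; rewrite stack_sym through_connect.
Qed.

Lemma loops_through D : loops X D = 0%N.
Proof.
apply: loops0 => -[[i|i]|i]; [by exists (inl i)| |by exists (inr i)].
by exists (top_perm s (inl i)); rewrite stack_sym; apply: through_connect.
Qed.

End Through.

(** * Stacking a diagram with a bottom arc on top of another *)

Section Cap.

Variables (X D : diagram n) (a b : 'I_n).
Hypothesis Xab : X (inr a) = inr b.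
Hypothesis Dab : D (inl a) != inl b.

(** The path of [G1] from [D a] through [a] and [b] to [D b] becomes in [G2] a direct arc from [D a]
    to [D b] and a separate loop on [ma] and [mb]. The map [contract] pushes the two inner points of
    the path to its ends. *)
Let E := splice (inl a) (inl b) D.
Let ma : vertex n := inl (inr a).
Let mb : vertex n := inl (inr b).
Let G1 := stack_adj X D.
Let G2 := stack_adj X E.
Let inner u := (u == ma) || (u == mb).
Let contract u :=
  if u == ma then lower (D (inl a)) else if u == mb then lower (D (inl b)) else u.

Let ab : a != b.
Proof. by apply: contraNneq (partner_neq X (inr a)) => ba; rewrite Xab ba. Qed.

Let ab' : (inl a : point n) != inl b.
Proof. by apply: contra_neq ab => -[]. Qed.

Let Xba : X (inr b) = inr a.
Proof. by rewrite -Xab partnerK. Qed.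

Let Eab : E (inl a) = inl b.
Proof. exact: splice_l. Qed.

Let Eba : E (inl b) = inl a.
Proof. by rewrite -Eab partnerK. Qed.

Let inner_lower p : inner (lower p) = (p == inl a) || (p == inl b).
Proof. by case: p => i; rewrite /inner /ma /mb. Qed.

Let inner_upper p : inner (upper p) = (p == inr a) || (p == inr b).
Proof. by case: p => i; rewrite /inner /ma /mb. Qed.

Let inner_outer p : inner (outer p) = false.
Proof. by case: p. Qed.

Let contract_id u : ~~ inner u -> contract u = u.
Proof. by rewrite /inner /contract => /norP[/negbTE-> /negbTE->]. Qed.

Let inner_adj u v : G2 u v -> inner u -> inner v.
Proof.
by case/stack_adjP=> -[p -> ->]; rewrite ?inner_lower ?inner_upper
  => /orP[] /eqP->; rewrite ?Xab ?Xba ?Eab ?Eba eqxx ?orbT.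
Qed.

Let G2_outer u v : connect G2 u v -> inner u = inner v.
Proof.
apply: (closed_connect (a := inner)); apply: intro_closed; first exact: stack_sym.
by move=> x y xy; apply: inner_adj.
Qed.

Let D_neq p : D p != p := partner_neq D p.

Let DaDb : connect G2 (lower (D (inl a))) (lower (D (inl b))).
Proof. by rewrite -(splice_partner ab' Dab); apply: stack_lower. Qed.

Let Db_neq : D (inl b) != inl a.
Proof. by apply: contra_neq Dab => <-; rewrite partnerK. Qed.

Let contract_a : contract ma = lower (D (inl a)).
Proof. by rewrite /contract eqxx. Qed.

Let contract_b : contract mb = lower (D (inl b)).
Proof.
rewrite /contract eqxx; case: eqP => // -[ba].
by have := ab; rewrite ba eqxx.
Qed.

(** Contraction turns the cap into the arc from [D a] to [D b] and shrinks the arcs of [D] at [a]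
    and [b] to points; all other edges survive. *)
Let G1_G2 u v : G1 u v -> connect G2 (contract u) (contract v).
Proof.
have cl p : contract (lower p) = if p == inl a then lower (D (inl a)) else
  if p == inl b then lower (D (inl b)) else lower p by case: p.
case/stack_adjP=> -[p -> ->].
  case: (boolP (inner (upper p))) => [|np].
    rewrite inner_upper => /orP[] /eqP->; rewrite ?Xab ?Xba.
      by rewrite -[upper (inr a)]/ma -[upper (inr b)]/mb contract_a contract_b DaDb.
    rewrite -[upper (inr a)]/ma -[upper (inr b)]/mb contract_a contract_b.
    by rewrite stack_sym DaDb.
  have nXp : ~~ inner (upper (X p)).
    rewrite inner_upper; move: np; rewrite inner_upper; apply: contra.
    by case/orP=> /eqP XE; rewrite -[p](partnerK X) XE ?Xab ?Xba eqxx ?orbT.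
  by rewrite !contract_id //; apply: stack_upper.
rewrite !cl.
have [->|pa] := eqVneq p (inl a); first by rewrite (negbTE (D_neq _)) (negbTE Dab).
have [->|pb] := eqVneq p (inl b); first by rewrite (negbTE (D_neq _)) (negbTE Db_neq).
have [Dpa|Dpa] := eqVneq (D p) (inl a); first by rewrite -Dpa partnerK.
have [Dpb|Dpb] := eqVneq (D p) (inl b); first by rewrite -Dpb partnerK.
by rewrite -(splice_far pa pb Dpa Dpb); apply: stack_lower.
Qed.

Let G1_splice_ends : connect G1 (lower (D (inl a))) (lower (D (inl b))).
Proof.
apply: connect_trans (_ : connect G1 _ ma) _.
  by rewrite stack_sym; apply: (stack_lower X D (inl a)).
apply: connect_trans (_ : connect G1 _ mb) _; last exact: (stack_lower X D (inl b)).
by have := stack_upper X D (inr a); rewrite Xab.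
Qed.

(** The edges of [E] that are not in [D] join [a] to [b], as the cap does already, and [D a] to
    [D b], which a path of [G1] replaces. *)
Let G2_G1 u v : G2 u v -> connect G1 u v.
Proof.
case/stack_adjP=> -[p -> ->]; first exact: stack_upper.
have [->|pa] := eqVneq p (inl a).
  by rewrite Eab; have := stack_upper X D (inr a); rewrite Xab.
have [->|pb] := eqVneq p (inl b).
  by rewrite Eba; have := stack_upper X D (inr b); rewrite Xba.
have [Dpa|Dpa] := eqVneq (D p) (inl a).
  by rewrite -[p](partnerK D) Dpa splice_partner // G1_splice_ends.
have [Dpb|Dpb] := eqVneq (D p) (inl b).
  rewrite -[p](partnerK D) Dpb.
  have -> : E (D (inl b)) = D (inl a).
    by rewrite -(splice_partner ab' Dab) partnerK.
  by rewrite stack_sym G1_splice_ends.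
by rewrite /E splice_far //; apply: stack_lower.
Qed.

Let connect12 u v : ~~ inner u -> ~~ inner v -> connect G1 u v = connect G2 u v.
Proof.
move=> nu nv; apply/idP/idP; last exact: (connect_map (h := id)).
by move/(connect_map G1_G2); rewrite !contract_id.
Qed.

Lemma comp_splice_neq : comp X D = comp X E.
Proof. by apply: eq_comp => p q; apply: connect12; rewrite inner_outer. Qed.

Let inner_connect : connect G2 ma =i inner.
Proof.
move=> u; change (connect G2 ma u = inner u); apply/idP/idP => [/G2_outer<-|].
  by rewrite /inner eqxx.
case/orP=> /eqP-> //.
by have := stack_upper X E (inr a); rewrite Xab.
Qed.

Let floating12 u : ~~ inner u -> (u \in floating X D) = (u \in floating X E).
Proof.
move=> nu; rewrite !inE; apply: eq_forallb => p.
by rewrite (connect12 nu) // inner_outer.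
Qed.

Let inner_floating u : inner u -> u \in floating X E.
Proof.
by move=> iu; apply/forallP => p; apply: contraL iu => /G2_outer->; rewrite inner_outer.
Qed.

Let lower_out p : p != inl a -> p != inl b -> ~~ inner (lower p).
Proof. by rewrite inner_lower => /negbTE-> /negbTE->. Qed.

Let contract_connect u : connect G1 u (contract u).
Proof.
rewrite /contract; have [->|_] := eqVneq u ma; first exact: (stack_lower X D (inl a)).
by have [->|//] := eqVneq u mb; apply: (stack_lower X D (inl b)).
Qed.

Let contract_inner u : ~~ inner (contract u).
Proof.
rewrite /contract; have [_|na] := eqVneq u ma; first by rewrite lower_out.
have [_|nb] := eqVneq u mb; first by rewrite lower_out.
by rewrite /inner (negbTE na) (negbTE nb).
Qed.

(** Away from the inner points both graphs have the same connections, while the inner points form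
    one additional closed component of [G2]. *)
Lemma loops_splice_neq : loops X E = (loops X D).+1.
Proof.
(* Inner points are sent to an outer point, which lies on no closed loop, so the preimage of the
   floating points under [h] omits the additional loop. *)
pose h u := if inner u then outer (inl a) else u.
have sym1 : connect_sym G1 := @stack_sym X D.
have sym2 : connect_sym G2 := @stack_sym X E.
have hE u : h u \in floating X D -> ~~ inner u.
  rewrite /h; case: ifP => // _ /forallP/(_ (inl a)).
  by rewrite connect0.
have -> : loops X D = n_comp G2 [preim h of floating X D].
  apply: adjunction_n_comp => //; first exact: floating_closed.
  split=> [u fu | u v fu].
    exists (contract u); rewrite /h (negbTE (contract_inner u)).
    exact: contract_connect.
  have nu := hE _ fu; rewrite /h (negbTE nu) in fu *.
  case: ifP => iv; last by rewrite connect12 // iv.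
  have /forallP/(_ (inl a))/negbTE-> := fu.
  by apply: contraNF nu => /G2_outer->.
rewrite /loops /n_comp_mem -(cardID inner) -add1n; congr (_ + _)%N.
  rewrite -(n_comp_connect sym2 ma); apply: eq_card => u.
  have := inner_connect u; rewrite !inE -!topredE /= => ->.
  case: (boolP (inner u)) => [iu|_]; rewrite ?andbF ?andbT //.
  by have := inner_floating iu; rewrite inE => ->; rewrite andbT.
apply: eq_card => u; rewrite !inE.
rewrite -[u \in inner]/(inner u) /h; case: (boolP (inner u)) => iu /=.
  apply/esym/negbTE/nandP; right; apply/negP => /forallP/(_ (inl a)).
  by rewrite connect0.
by congr andb; have := floating12 iu; rewrite !inE => ->.
Qed.

End Cap.

Lemma comp_splice X D a b : X (inr a) = inr b ->
  comp X (splice (inl a) (inl b) D) = comp X D.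
Proof.
have [Dab|Dab] := eqVneq (D (inl a)) (inl b); first by rewrite splice_id.
by move=> Xab; rewrite -comp_splice_neq.
Qed.

Lemma loops_splice X D a b : X (inr a) = inr b ->
  loops X (splice (inl a) (inl b) D) = (loops X D + (D (inl a) != inl b))%N.
Proof.
have [Dab|Dab] := eqVneq (D (inl a)) (inl b); first by rewrite splice_id // addn0.
by move=> Xab; rewrite loops_splice_neq // addn1.
Qed.

End Stack.

(** * Products with the generators *)

Section Generators.

Variables (n : nat) (i : 'I_n.-1).
Implicit Types (D Z : diagram n).

Definition gen_l : 'I_n := Ordinal (ltnW (gen_ltS i)).
Definition gen_r : 'I_n := Ordinal (gen_ltS i).

Lemma gen_lr : gen_l != gen_r.
Proof. by rewrite -val_eqE /= neq_ltn ltnSn. Qed.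

Lemma gen_rl : (gen_r == gen_l) = false.
Proof. by rewrite eq_sym (negbTE gen_lr). Qed.

Lemma e_diag_inl : e_diag i (inl gen_l) = inl gen_r.
Proof. by rewrite /= ffunE eqxx. Qed.

Lemma e_diag_inr : e_diag i (inr gen_l) = inr gen_r.
Proof. by rewrite /= ffunE eqxx. Qed.

Lemma e_diag_far j : j != gen_l -> j != gen_r -> e_diag i (inl j) = inr j.
Proof. by move=> jl jr; rewrite /= ffunE (negbTE jl) (negbTE jr). Qed.

Lemma v_diag_inr j : v_diag i (inr j) = inl (tperm gen_l gen_r j).
Proof.
rewrite /= ffunE; have [->|jl] := eqVneq j gen_l; first by rewrite tpermL.
have [->|jr] := eqVneq j gen_r; first by rewrite tpermR.
by rewrite tpermD // eq_sym.
Qed.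

Section CappedDiagram.

Variable Z : diagram n.
Hypothesis Zlr : Z (inl gen_l) = inl gen_r.

Let G := stack_adj (e_diag i) Z.
Let ml : vertex n := inl (inr gen_l).
Let mr : vertex n := inl (inr gen_r).
Let inner (u : vertex n) := (u == ml) || (u == mr).

Let Zrl : Z (inl gen_r) = inl gen_l.
Proof. by rewrite -Zlr partnerK. Qed.

Let err : e_diag i (inr gen_r) = inr gen_l.
Proof. by rewrite -e_diag_inr partnerK. Qed.

Let outer_lower p : p != inl gen_l -> p != inl gen_r ->
  connect G (outer p) (lower p).
Proof.
case: p => j // jl jr; rewrite /= -/(upper (inr j)) -(@e_diag_far j).
- exact: (stack_upper (e_diag i) Z (inl j)).
- by apply: contra_neq jl => ->.
- by apply: contra_neq jr => ->.
Qed.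

(** The top arc of [e_diag i] reproduces the arc of [Z] that closes up with its bottom arc; vertical
    strands prolong the other arcs of [Z]. *)
Lemma comp_e_diag_cap : comp (e_diag i) Z = Z.
Proof.
have lr : connect G (outer (inl gen_l)) (outer (inl gen_r)).
  by have := stack_upper (e_diag i) Z (inl gen_l); rewrite e_diag_inl.
apply: comp_eqP => p; rewrite -/G.
have [->|pl] := eqVneq p (inl gen_l); first by rewrite Zlr.
have [->|pr] := eqVneq p (inl gen_r); first by rewrite Zrl stack_sym.
apply: connect_trans (outer_lower pl pr) _.
apply: connect_trans (stack_lower _ Z p) _; rewrite stack_sym.
apply: outer_lower.
  by apply: contra_neq pr => Zp; rewrite -(partnerK Z p) Zp.
by apply: contra_neq pl => Zp; rewrite -(partnerK Z p) Zp.
Qed.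

Let inner_adj u v : G u v -> inner u -> inner v.
Proof.
have iu p : inner (upper p) = (p == inr gen_l) || (p == inr gen_r) by case: p.
have il p : inner (lower p) = (p == inl gen_l) || (p == inl gen_r) by case: p.
by case/stack_adjP=> -[p -> ->]; rewrite ?iu ?il => /orP[] /eqP->;
  rewrite ?e_diag_inr ?err ?Zlr ?Zrl eqxx ?orbT.
Qed.

Lemma loops_e_diag_cap : loops (e_diag i) Z = 1%N.
Proof.
have symG : connect_sym G := @stack_sym _ _ _.
have innerP u v : connect G u v -> inner u = inner v.
  apply: (closed_connect (a := inner)); exact: intro_closed.
rewrite /loops -(n_comp_connect symG ml); apply: eq_n_comp_r => u.
rewrite [RHS]inE [LHS]inE; apply/forallP/idP => [uN|mlu p].
  suff: inner u.
    case/orP=> /eqP-> //.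
    by have := stack_upper (e_diag i) Z (inr gen_l); rewrite e_diag_inr.
  case: u uN => [[j|j]|j] uN.
  - by have := uN (inl j); rewrite connect0.
  - rewrite /inner; have [//|jl] := eqVneq (inl (inr j) : vertex n) ml.
    have [//|jr] := eqVneq (inl (inr j) : vertex n) mr.
    have /negP[] := uN (inl j); rewrite symG; apply: (@outer_lower (inl j)).
      by apply: contra_neq jl => -[->].
    by apply: contra_neq jr => -[->].
  - by have := uN (inr j); rewrite connect0.
rewrite symG; apply/negP => pu.
have := innerP _ _ (connect_trans mlu (etrans (symG _ _) pu)).
by rewrite /inner eqxx; case: p {pu}.
Qed.

End CappedDiagram.

(** Splicing does not change the composite, and the spliced diagram has the arc that makes
    [comp_e_diag_cap] apply. *)
Lemma comp_e_diag D :
  comp (e_diag i) D = splice (inl gen_l) (inl gen_r) D.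
Proof.
rewrite -(comp_splice D e_diag_inr) comp_e_diag_cap // splice_l //.
by rewrite (inj_eq inl_inj) gen_lr.
Qed.

(** The spliced diagram gives exactly one loop, and splicing has added that loop unless the arc was
    there before. *)
Lemma loops_e_diag D : loops (e_diag i) D = (D (inl gen_l) == inl gen_r).
Proof.
have := loops_splice D e_diag_inr; rewrite loops_e_diag_cap; last first.
  by rewrite splice_l // (inj_eq inl_inj) gen_lr.
case: eqP => _ /=; first by rewrite addn0 => <-.
by rewrite addn1 => -[].
Qed.

End Generators.

(** * Reflection in a horizontal line *)

Section Flip.

Variable n : nat.
Implicit Types (X Y D : diagram n) (p : point n) (u : vertex n).

Definition swap_point p : point n := match p with inl i => inr i | inr i => inl i end.

Lemma swap_pointK : involutive swap_point. Proof. by case. Qed.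

Definition swap_perm : {perm point n} := perm (inv_inj swap_pointK).

Definition flip : diagram n -> diagram n := relabel swap_perm.

Lemma swap_permV : swap_perm^-1%g = swap_perm.
Proof.
apply: (mulIg swap_perm); rewrite mulVg; apply/permP => p.
by rewrite perm1 permM !permE swap_pointK.
Qed.

Lemma flipE X p : flip X (swap_point p) = swap_point (X p).
Proof. by have := relabelE swap_perm X p; rewrite !permE. Qed.

Lemma flipK : involutive flip.
Proof. by move=> X; have := relabelK swap_perm X; rewrite swap_permV. Qed.

Definition swap_vertex u : vertex n :=
  match u with
  | inl (inl i) => inr i | inl (inr i) => inl (inr i) | inr i => inl (inl i)
  end.

Lemma swap_vertexK : involutive swap_vertex.
Proof. by case=> [[]|]. Qed.

(** Reflection turns the stack upside down and hence exchanges the two factors. *)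
Lemma flip_connect X Y u v :
  connect (stack_adj (flip X) (flip Y)) (swap_vertex u) (swap_vertex v) =
  connect (stack_adj Y X) u v.
Proof.
have wU p : swap_vertex (upper p) = lower (swap_point p) by case: p.
have wL p : swap_vertex (lower p) = upper (swap_point p) by case: p.
suff H X' Y' u' v' : connect (stack_adj Y' X') u' v' ->
    connect (stack_adj (flip X') (flip Y')) (swap_vertex u') (swap_vertex v').
  by apply/idP/idP => /H //; rewrite !flipK !swap_vertexK.
apply: connect_map => {}u' {}v' /stack_adjP[] [p -> ->].
  by rewrite !wU -flipE stack_lower.
by rewrite !wL -flipE stack_upper.
Qed.

Lemma swap_outer p : swap_vertex (outer p) = outer (swap_point p).
Proof. by case: p. Qed.

Lemma comp_flip X Y : comp (flip X) (flip Y) = flip (comp Y X).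
Proof.
apply: comp_eqP => p; rewrite -[p]swap_pointK; move: (swap_point p) => q.
rewrite flipE -!swap_outer flip_connect.
by have [_ ->] := comp_funP Y X q; rewrite eqxx orbT.
Qed.

Lemma loops_flip X Y : loops (flip X) (flip Y) = loops Y X.
Proof.
have -> : loops (flip X) (flip Y) = n_comp (stack_adj Y X)
    [preim swap_vertex of floating (flip X) (flip Y)].
  apply: adjunction_n_comp; [exact: stack_sym | exact: stack_sym
    | exact: floating_closed | split=> [u _|u v _]].
    by exists (swap_vertex u); rewrite swap_vertexK.
  by rewrite flip_connect.
apply: eq_n_comp_r => u; rewrite !inE; apply/forallP/forallP => uN p.
  by have := uN (swap_point p); rewrite -swap_outer flip_connect.
by rewrite -[p]swap_pointK -swap_outer flip_connect.
Qed.

Lemma flip_e_diag i : flip (e_diag i) = e_diag i.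
Proof.
apply: diagramP => p; rewrite -[p]swap_pointK flipE.
by case: p => j; rewrite /= !ffunE /=; do 2?case: eqP.
Qed.

Lemma flip_v_diag i : flip (v_diag i) = v_diag i.
Proof.
apply: diagramP => p; rewrite -[p]swap_pointK flipE.
by case: p => j; rewrite /= !ffunE /=; do 2?case: eqP.
Qed.

End Flip.

(** * Counting the points on bottom arcs *)

Section BottomArcs.

Variable n : nat.
Implicit Types (X Y Z D : diagram n) (p a b : point n).

Definition is_bottom p := if p is inr _ then true else false.

Definition bottom_arcs X : pred (point n) :=
  [pred p | is_bottom p && is_bottom (X p)].

Lemma in_bottom_arcs X p :
  (p \in bottom_arcs X) = is_bottom p && is_bottom (X p).
Proof. by rewrite inE. Qed.

Definition num_bottom X : nat := #|bottom_arcs X|.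

Lemma num_bottom_through X : num_bottom X = 0%N ->
  exists s : 'S_n, forall j, X (inr j) = inl (s j).
Proof.
move=> X0; have Xtop j : exists k, X (inr j) = inl k.
  have := card0_eq X0 (inr j); rewrite !inE /=.
  by case: (X (inr j)) => // k _; exists k.
pose h j := if X (inr j) is inl k then k else j.
have hE j : X (inr j) = inl (h j) by rewrite /h; have [k ->] := Xtop j.
have h_inj : injective h.
  move=> j k hjk; have : X (inr j) = X (inr k) by rewrite !hE hjk.
  by move/(inv_inj (@partnerK n X)) => -[].
by exists (perm h_inj) => j; rewrite permE.
Qed.

Lemma num_bottom_arc X : num_bottom X != 0%N ->
  exists a b : 'I_n, X (inr a) = inr b.
Proof.
rewrite -lt0n => /card_gt0P[[a|a]]; rewrite inE //=.
by case Xa: (X (inr a)) => [//|b] _; exists a, b.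
Qed.

Lemma num_bottom_relabel (s : 'S_n) X :
  num_bottom (relabel (top_perm s) X) = num_bottom X.
Proof.
have botE p : is_bottom (top_perm s p) = is_bottom p by rewrite permE; case: p.
rewrite /num_bottom -[RHS](card_image (@perm_inj _ (top_perm s))); apply: eq_card => p.
rewrite -[p](permKV (top_perm s)) mem_image; last exact: perm_inj.
by rewrite !in_bottom_arcs relabelE !botE.
Qed.

(** The two rows have the same size and through arcs use equally many points of each, so equally
    many points remain for top arcs and for bottom arcs. *)
Lemma num_bottom_flip X : num_bottom (flip X) = num_bottom X.
Proof.
pose top := [pred p : point n | ~~ is_bottom p].
have topE : #|top| = #|[pred p : point n | is_bottom p]|.
  rewrite -[RHS](card_image (inv_inj (@swap_pointK n))); apply: eq_card => p.
  rewrite -[p]swap_pointK mem_image; last exact: inv_inj (@swap_pointK n).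
  by rewrite !inE; case: (swap_point p).
have -> : num_bottom (flip X) = #|[predI top & [pred p | ~~ is_bottom (X p)]]|.
  rewrite -[RHS](card_image (inv_inj (@swap_pointK n))); apply: eq_card => p.
  rewrite -[p]swap_pointK mem_image; last exact: inv_inj (@swap_pointK n).
  rewrite in_bottom_arcs flipE !inE.
  by case: (swap_point p) => j /=; case: (X _).
(* Adding the number of through arcs, counted by their top ends, makes either side the size of a
   row. *)
apply/eqP; rewrite -(eqn_add2r #|[predD top & [pred p | ~~ is_bottom (X p)]]|).
rewrite addnC [in X in X == _]addnC cardID topE.
rewrite -(cardID [pred p | is_bottom (X p)] [pred p : point n | is_bottom p]).
apply/eqP; congr (_ + _)%N.
rewrite -[RHS](card_image (inv_inj (@partnerK n X))); apply: eq_card => p.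
rewrite -[p](partnerK X) mem_image; last exact: inv_inj (@partnerK n X).
by rewrite !inE partnerK /= negbK andbC.
Qed.

Section ExchangeBottom.

Variables (a b : point n) (Z : diagram n).
Hypotheses (ta : ~~ is_bottom a) (tb : ~~ is_bottom b) (Zab : Z a = b).

Let Zba : Z b = a. Proof. by rewrite -Zab partnerK. Qed.

(** For [p] other than [b], the arcs from [a] to [b] and from [p] to [Z p] become arcs from [a] to
    [p] and from [b] to [Z p]. Since [a] and [b] lie at the top, neither new arc is a bottom arc, so
    the count drops only if the arc at [p] was one. *)
Lemma num_bottom_exchange p : p != a ->
  num_bottom (relabel (tperm b p) Z) =
    if bottom_arcs Z p then (num_bottom Z).-2 else num_bottom Z.
Proof.
move=> pa.
have -> : num_bottom (relabel (tperm b p) Z) =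
    #|[predD bottom_arcs Z & [pred q | bottom_arcs Z p && ((q == p) || (q == Z p))]]|.
  apply: eq_card => q.
  have -> : (q \in bottom_arcs (relabel (tperm b p) Z)) =
      is_bottom q && is_bottom (tperm b p (Z (tperm b p q))).
    by rewrite inE /= ffunE tpermV.
  rewrite !inE; have [->|qp] := eqVneq q p.
    rewrite tpermR Zba tpermD //; last by rewrite -Zab partner_neq.
    by rewrite (negbTE ta) andbF andbT -in_bottom_arcs -topredE andNb.
  have [->|qb] := eqVneq q b; first by rewrite (negbTE tb) andbF.
  rewrite (tpermD (z := q)); try by rewrite eq_sym.
  case: (tpermP b p (Z q)) => [Zq|Zq|_ Zqp].
  - by rewrite -[q](partnerK Z) Zq Zba (negbTE ta) /= andbF.
  - rewrite -Zq partnerK eqxx (negbTE tb) orbT andbT andbF.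
    rewrite -[bottom_arcs Z (Z q)]/(is_bottom (Z q) && is_bottom (Z (Z q))).
    by rewrite partnerK [X in ~~ X]andbC andNb.
  have -> : (q == Z p) = false.
    by apply/eqP => qZ; apply: Zqp; rewrite qZ partnerK.
  by rewrite andbF.
case: ifP => [arc|_]; last by apply: eq_card => q; rewrite !inE.
rewrite /num_bottom -(cardID [pred q | (q == p) || (q == Z p)] (bottom_arcs Z)).
have -> : #|[predI bottom_arcs Z & [pred q | (q == p) || (q == Z p)]]| = 2%N.
  rewrite -(_ : #|pred2 p (Z p)| = 2%N); last by rewrite card2 eq_sym partner_neq.
  apply: eq_card => q; rewrite !inE; case/andP: arc => bp bZp.
  have [->|_] := eqVneq q p; first by rewrite bp bZp.
  by have [->|_] := eqVneq q (Z p); rewrite ?partnerK ?bp ?bZp ?andbF.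
by rewrite add2n /=; apply: eq_card => q; rewrite !inE.
Qed.

End ExchangeBottom.

End BottomArcs.

(** * The diagram algebra over a field *)

Section DiagramAlgebra.

Variables (F : fieldType) (delta : F) (n : nat).
Implicit Types (f g : {ffun diagram n -> F}) (X Y Z D : diagram n).
Implicit Types (p a b : point n).

Definition dzero : {ffun diagram n -> F} := [ffun => 0].

Definition dbasis X : {ffun diagram n -> F} := [ffun Z => (Z == X)%:R].

Definition dmul f g : {ffun diagram n -> F} :=
  [ffun Z => \sum_X \sum_Y f X * g Y * delta ^+ loops X Y * (Z == comp X Y)%:R].

Lemma dmul_basisE X g Z : dmul (dbasis X) g Z =
  \sum_Y g Y * delta ^+ loops X Y * (Z == comp X Y)%:R.
Proof.
rewrite ffunE (bigD1 X) //= [X in _ + X]big1 ?addr0.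
  by apply: eq_bigr => Y _; rewrite ffunE eqxx mul1r.
move=> X' /negbTE X'X; rewrite big1 // => Y _.
by rewrite ffunE X'X !mul0r.
Qed.

Lemma dmulE f g Z : dmul f g Z = \sum_X f X * dmul (dbasis X) g Z.
Proof.
rewrite {1}/dmul ffunE; apply: eq_bigr => X _.
rewrite dmul_basisE big_distrr /=; apply: eq_bigr => Y _.
by rewrite !mulrA.
Qed.

(* The coefficient of [Z] in the product of [f] by the diagram that caps off
   [a] and [b]. *)
Definition cap_coef f a b Z : F :=
  \sum_(D | splice a b D == Z) f D * delta ^+ (D a == b).

Lemma e_mulE i f Z :
  dmul (dbasis (e_diag i)) f Z = cap_coef f (inl (gen_l i)) (inl (gen_r i)) Z.
Proof.
rewrite dmul_basisE /cap_coef [RHS]big_mkcond; apply: eq_bigr => Y _.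
rewrite comp_e_diag loops_e_diag [Z == _]eq_sym.
by case: (_ == Z); rewrite ?mulr1 ?mulr0.
Qed.

(** Composition with [X] sees [D] only through its splice, so the product groups by spliced diagrams
    into a combination of cap coefficients. *)
Lemma cap_mul0 X (a b : 'I_n) f : delta != 0 -> X (inr a) = inr b ->
    (forall Z, cap_coef f (inl a) (inl b) Z = 0) ->
  dmul (dbasis X) f = dzero.
Proof.
move=> d0 Xab f0; apply/ffunP => Z; rewrite [RHS]ffunE dmul_basisE.
(* The extra [delta] balances the loops: splicing adds a loop exactly when [D] lacks the arc, and
   [cap_coef] carries a factor [delta] exactly when [D] has it. *)
apply: (mulfI d0); rewrite mulr0 big_distrr /=.
pose w W : F := delta ^+ loops X W * (Z == comp X W)%:R.
transitivity (\sum_W cap_coef f (inl a) (inl b) W * w W); last first.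
  by apply: big1 => W _; rewrite f0 mul0r.
rewrite (partition_big (splice (inl a) (inl b)) predT) //=.
apply: eq_bigr => W _; rewrite /cap_coef big_distrl /=.
apply: eq_bigr => D /eqP<-; rewrite /w comp_splice // loops_splice // exprD.
rewrite -!mulrA mulrCA; congr (_ * _); rewrite !mulrA; congr (_ * _).
by case: eqP => _ /=; rewrite ?expr1 ?expr0 ?mulr1 ?mul1r // mulrC.
Qed.

Lemma cap_coef_relabel f (s : {perm point n}) a b Z :
    (forall D, f (relabel s D) = f D) ->
  cap_coef f (s a) (s b) (relabel s Z) = cap_coef f a b Z.
Proof.
move=> fs; rewrite /cap_coef (reindex (relabel s)) /=; last first.
  by exists (relabel s^-1%g) => D _; rewrite ?relabelK ?relabelVK.
apply: eq_big => [D|D _]; first by rewrite splice_relabel (inj_eq (@relabel_inj _ s)).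
by rewrite fs relabelE (inj_eq perm_inj).
Qed.

Lemma through_mulE X (s : 'S_n) f D : (forall j, X (inr j) = inl (s j)) ->
  dmul (dbasis X) f (relabel (top_perm s) D) = f D.
Proof.
move=> Xs; rewrite dmul_basisE (bigD1 D) //= big1 => [|Y /negbTE YD].
  rewrite addr0 (loops_through Xs) (comp_through Xs).
  by rewrite eqxx mulr1 expr0 mulr1.
by rewrite (comp_through Xs) (inj_eq (@relabel_inj _ _)) eq_sym YD mulr0.
Qed.

(** Adjacent transpositions generate the symmetric group. *)
Lemma v_invariant f : (forall i, dmul (dbasis (v_diag i)) f = f) ->
  forall (s : 'S_n) D, f (relabel (top_perm s) D) = f D.
Proof.
move=> fv; pose inv s := forall D, f (relabel (top_perm s) D) = f D.
have invM s t : inv s -> inv t -> inv (s * t)%g.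
  by move=> fs ft D; rewrite top_permM relabelM ft fs.
have inv1 : inv 1%g by move=> D; rewrite top_perm1 relabel1.
have adj (j k : 'I_n) : k = j.+1 :> nat -> inv (tperm j k).
  move=> kj; have ltj : (j < n.-1)%N by rewrite ltn_predRL -kj.
  have -> : j = gen_l (Ordinal ltj) by apply: val_inj.
  have -> : k = gen_r (Ordinal ltj) by apply: val_inj.
  move=> D; rewrite -{1}(fv (Ordinal ltj)); apply: through_mulE => l.
  exact: v_diag_inr.
(* Conjugation by an adjacent transposition brings [k] one step closer to [j]. *)
have dist m (j k : 'I_n) : k = (m + j.+1)%N :> nat -> inv (tperm j k).
  elim: m k => [|m IH] k km; first exact: adj.
  have ltk : (m + j.+1 < n)%N by apply: leq_trans (ltn_ord k); rewrite km.
  pose k' := Ordinal ltk.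
  have kk' : inv (tperm k' k) by apply: adj.
  have -> : tperm j k = (tperm k' k * tperm j k' * tperm k' k)%g.
    rewrite -{1}[tperm k' k]tpermV -mulgA -/(conjg _ _) tpermJ tpermL.
    by rewrite tpermD // -val_eqE gtn_eqF //= ?km leq_addl.
  by apply: (invM _ _ (invM _ _ kk' (IH k' _)) kk').
move=> s; have [ts -> _] := prod_tpermP s; elim/big_ind: _ => // -[j k] _ /=.
case: (ltngtP j k) => [jk|kj|/val_inj->]; last by rewrite tperm1.
  by apply: (dist (k - j.+1)%N); rewrite subnK.
by rewrite tpermC; apply: (dist (j - k.+1)%N); rewrite subnK.
Qed.

Lemma left_absorb f : delta != 0 ->
    (forall i, dmul (dbasis (e_diag i)) f = dzero) ->
    (forall i, dmul (dbasis (v_diag i)) f = f) ->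
  forall X, dmul (dbasis X) f = if num_bottom X == 0%N then f else dzero.
Proof.
move=> d0 fe /v_invariant finv X; case: ifPn => [/eqP X0|].
  have [s Xs] := num_bottom_through X0; apply/ffunP => Z.
  by rewrite -(relabelVK (top_perm s) Z) (through_mulE _ _ Xs) finv.
case/num_bottom_arc => a [b Xab]; apply: (cap_mul0 d0 Xab) => Z.
have ab : b != a by apply: contraNneq (partner_neq X (inr a)) => ba; rewrite Xab ba.
(* Two distinct points [a] and [b] force [n] to be at least two, so a first generator exists. *)
have n1 : (0 < n.-1)%N.
  rewrite ltn_predRL ltnNge; apply: contraNN ab => n1.
  have lt1 (j : 'I_n) : j = 0%N :> nat.
    by have := leq_trans (ltn_ord j) n1; case: (val j).
  by rewrite -val_eqE /= !lt1.
(* The permutation [s] carries the ends of the first generator to [a] and [b]: its first factor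
   places the left end and sends the right end to [r], which the second factor moves to [b]. *)
pose i := Ordinal n1; pose r := tperm (gen_l i) a (gen_r i).
pose s := (tperm (gen_l i) a * tperm r b)%g.
have sl : s (gen_l i) = a.
  rewrite permM tpermL tpermD // /r.
  by rewrite -[X in _ != X](tpermL (gen_l i) a) (inj_eq perm_inj) gen_rl.
have sr : s (gen_r i) = b by rewrite permM tpermL.
rewrite -{1}sl -{1}sr -!top_perml -(relabelVK (top_perm s) Z).
by rewrite cap_coef_relabel // -e_mulE fe ffunE.
Qed.

Definition dflip f : {ffun diagram n -> F} := [ffun D => f (flip D)].

Lemma dflipK : involutive dflip.
Proof. by move=> f; apply/ffunP => D; rewrite !ffunE flipK. Qed.

Lemma dflip0 : dflip dzero = dzero.
Proof. by apply/ffunP => D; rewrite !ffunE. Qed.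

Lemma dflip_basis X : dflip (dbasis X) = dbasis (flip X).
Proof.
apply/ffunP => D; rewrite !ffunE.
by rewrite -(inj_eq (inv_inj (@flipK n))) flipK.
Qed.

Lemma dflip_mul f g : dflip (dmul f g) = dmul (dflip g) (dflip f).
Proof.
apply/ffunP => Z; rewrite !ffunE exchange_big /= (reindex_inj (inv_inj (@flipK n))) /=.
apply: eq_bigr => Y _; rewrite (reindex_inj (inv_inj (@flipK n))) /=.
apply: eq_bigr => X _; rewrite !ffunE loops_flip comp_flip.
rewrite (inj_eq (inv_inj (@flipK n))); congr (_ * _); congr (_ * _).
by rewrite mulrC.
Qed.

End DiagramAlgebra.

(** * The Jones-Wenzl idempotent for a generic parameter *)

Section JonesWenzl.

Variables (F : fieldType) (delta : F) (n : nat).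
(** Characteristic zero makes the number of permutation diagrams invertible; genericity keeps
    [delta] and the denominators of [jw_coef] nonzero. *)
Hypothesis F_char0 : forall m, (m%:R == 0 :> F) = (m == 0%N).
Hypothesis delta_generic : forall m, delta + m%:R != 0.
Implicit Types (f : {ffun diagram n -> F}) (X Y Z D : diagram n).

Let delta0 : delta != 0.
Proof. by have := delta_generic 0; rewrite addr0. Qed.

(* The recursion is what makes a cap kill the sum of [jw_coef (num_bottom D)]
   times [D]: splitting a cap of [Z] against another arc destroys two bottom
   points on bottom arcs if that arc is at the bottom, and none otherwise. *)
Fixpoint jw_coef (t : nat) : F :=
  if t is t'.+1 then - (t%:R / (delta + (n.*2 - 2 - t)%:R)) * jw_coef t'.-1
  else 1.

(** The definition truncates its subtractions in the same way, so clearing the denominator works for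
    every positive [t]. *)
Lemma jw_coef_rec t : (0 < t)%N ->
  jw_coef t * delta + (t%:R * jw_coef t.-2 + (n.*2 - 2 - t)%:R * jw_coef t) = 0.
Proof.
case: t => // t _; rewrite [t.+1.-2]/(t.-1) /=.
by field; rewrite delta_generic.
Qed.

(** This is the image of [n!], the number of permutation diagrams; dividing by it makes the
    coefficients on these diagrams sum to one. *)
Definition jw_norm : F := #|[pred D : diagram n | num_bottom D == 0%N]|%:R.

Definition jw : {ffun diagram n -> F} :=
  [ffun D => jw_coef (num_bottom D) / jw_norm].

(** A diagram with splice [Z] is recovered from the partner [p] of [a] by exchanging [b] and [p] in
    [Z]; the case where [p] is [b] gives [Z] itself and the factor [delta]. Every splice joins [a]
    to [b], so nothing contributes if [Z] does not. *)
Lemma cap_coefE f a b Z : a != b -> cap_coef delta f a b Z =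
  if Z a == b then f Z * delta +
    \sum_(p | (p != a) && (p != b)) f (relabel (tperm b p) Z) else 0.
Proof.
move=> ab; rewrite /cap_coef; case: ifPn => [/eqP Zab|Zab]; last first.
  by apply: big1 => D /eqP spD; rewrite -spD splice_l // eqxx in Zab.
have ZpE p : p != a -> relabel (tperm b p) Z a = p.
  move=> pa; have := relabelE (tperm b p) Z a.
  by rewrite Zab tpermL tpermD // eq_sym.
rewrite (reindex_onto (fun p => relabel (tperm b p) Z) (fun D => D a));
  last by move=> D /eqP <-; apply: spliceK.
rewrite (eq_bigl (fun p => p != a)) => [|p]; last first.
  have [->|pa] := eqVneq p a; first by rewrite (negbTE (partner_neq _ _)) andbF.
  by rewrite /splice ZpE // -relabelM tperm2 relabel1 !eqxx.
rewrite (bigD1 b); last by rewrite eq_sym.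
congr (_ + _); first by rewrite tperm1 relabel1 Zab eqxx expr1.
apply: eq_bigr => p /andP[pa pb].
by rewrite ZpE // (negbTE pb) expr0 mulr1.
Qed.

(** Besides [a] and [b] there are [2n - 2] points. The [t] of them on bottom arcs contribute
    [jw_coef t.-2] each and the others [jw_coef t], up to the common norm, so the recursion gives
    zero. *)
Lemma jw_cap (a b : 'I_n) Z : a != b ->
  cap_coef delta jw (inl a) (inl b) Z = 0.
Proof.
move=> ab; have ab' : (inl a : point n) != inl b by rewrite (inj_eq inl_inj).
rewrite cap_coefE //; case: eqP => // Zab; set t := num_bottom Z.
(* By reflection, the top arc of [Z] forces a bottom arc. *)
have t_gt0 : (0 < t)%N.
  rewrite /t -num_bottom_flip; apply/card_gt0P; exists (inr a).
  by rewrite in_bottom_arcs -[inr a]/(swap_point (inl a)) flipE Zab.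
rewrite (eq_bigr (fun p => (if bottom_arcs Z p then jw_coef t.-2 else jw_coef t)
    / jw_norm)) => [|p /andP[pa _]]; last first.
  by rewrite ffunE (num_bottom_exchange (a := inl a)) //; case: ifP.
rewrite ffunE -mulr_suml mulrAC -mulrDl.
have arcE p : (p != inl a) && (p != inl b) && bottom_arcs Z p = (p \in bottom_arcs Z).
  rewrite -[bottom_arcs Z p]/(p \in bottom_arcs Z) andb_idl // in_bottom_arcs.
  by case: p => j // /andP[].
suff -> : \sum_(p | (p != inl a) && (p != inl b))
    (if bottom_arcs Z p then jw_coef t.-2 else jw_coef t) =
    t%:R * jw_coef t.-2 + (n.*2 - 2 - t)%:R * jw_coef t.
  by rewrite jw_coef_rec // mul0r.
rewrite (bigID (bottom_arcs Z)) /=; congr (_ + _).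
  rewrite (eq_bigr (fun=> jw_coef t.-2)) => [|p /andP[_ ->]] //.
  rewrite sumr_const -[LHS]mulr_natl; congr (_%:R * _).
  exact: eq_card.
rewrite (eq_bigr (fun=> jw_coef t)) => [|p /andP[_ /negbTE->]] //.
rewrite sumr_const -[LHS]mulr_natl; congr (_%:R * _).
have -> : (n.*2 - 2)%N = #|[predC pred2 (inl a : point n) (inl b)]|.
  have := cardC (pred2 (inl a : point n) (inl b)).
  by rewrite card2 ab' card_sum card_ord addnn => <-; rewrite addKn.
rewrite -[in RHS](cardID (bottom_arcs Z)); set c := #|[predI _ & _]|.
have -> : c = t.
  by apply: eq_card => p; rewrite -arcE !inE negb_or.
rewrite addKn; apply: eq_card => p.
by rewrite -[LHS]/((p != inl a) && (p != inl b) && (p \notin bottom_arcs Z))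
  !inE negb_or andbC.
Qed.

Lemma jw_v i : dmul delta (dbasis F (v_diag i)) jw = jw.
Proof.
apply/ffunP => Z; pose s := top_perm (tperm (gen_l i) (gen_r i)).
rewrite -(relabelVK s Z) (through_mulE _ _ _ (@v_diag_inr n i)) !ffunE.
by rewrite num_bottom_relabel.
Qed.

Lemma jw_e i : dmul delta (dbasis F (e_diag i)) jw = dzero F n.
Proof. by apply/ffunP => Z; rewrite e_mulE jw_cap ?gen_lr // ffunE. Qed.

Lemma jw_flip : dflip jw = jw.
Proof. by apply/ffunP => D; rewrite !ffunE num_bottom_flip. Qed.

Definition identity_fun : {ffun point n -> point n} := [ffun p => swap_point p].

Lemma identity_matching : is_matching identity_fun.
Proof. by apply/forallP => p; rewrite !ffunE swap_pointK eqxx; case: p. Qed.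

Lemma num_bottom_identity : num_bottom (Diagram identity_matching) = 0%N.
Proof. by apply: eq_card0 => p; rewrite in_bottom_arcs ffunE; case: p. Qed.

Lemma jw_norm_neq0 : jw_norm != 0.
Proof.
rewrite F_char0 -lt0n; apply/card_gt0P; exists (Diagram identity_matching).
by rewrite inE num_bottom_identity.
Qed.

Lemma jw_neq0 : jw <> dzero F n.
Proof.
move/ffunP/(_ (Diagram identity_matching)).
rewrite !ffunE num_bottom_identity /= mul1r => /eqP.
by rewrite invr_eq0 (negbTE jw_norm_neq0).
Qed.

(** This is the scalar by which [f] acts from the left on any element that the [e_diag i] kill and
    the [v_diag i] fix from the left. *)
Definition through_sum f : F := \sum_(X | num_bottom X == 0%N) f X.

Lemma left_absorb_mul f g :
    (forall i, dmul delta (dbasis F (e_diag i)) f = dzero F n) ->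
    (forall i, dmul delta (dbasis F (v_diag i)) f = f) ->
  dmul delta g f = [ffun Z => through_sum g * f Z].
Proof.
move=> fe fv; apply/ffunP => Z; rewrite dmulE [RHS]ffunE big_distrl [RHS]big_mkcond /=.
apply: eq_bigr => X _; rewrite (left_absorb delta0 fe fv).
by case: ifP; rewrite // ffunE mulr0.
Qed.

Lemma jw_sum : through_sum jw = 1.
Proof.
rewrite /through_sum (eq_bigr (fun=> jw_norm^-1)) => [|X /eqP X0]; last first.
  by rewrite ffunE X0 mul1r.
by rewrite sumr_const -[LHS]mulr_natl mulfV // jw_norm_neq0.
Qed.

Definition is_jones_wenzl f :=
  f <> dzero F n /\ dmul delta f f = f /\
  (forall i, dmul delta f (dbasis F (e_diag i)) = dzero F n /\
             dmul delta (dbasis F (e_diag i)) f = dzero F n) /\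
  (forall i, dmul delta f (dbasis F (v_diag i)) = f /\
             dmul delta (dbasis F (v_diag i)) f = f).

Lemma is_jones_wenzl_flip f : is_jones_wenzl f -> is_jones_wenzl (dflip f).
Proof.
move=> [f0 [ff [fe fv]]]; split=> [fz|].
  by apply: f0; rewrite -[f]dflipK fz dflip0.
split; first by rewrite -dflip_mul ff.
split=> i.
  have [fe1 fe2] := fe i; rewrite -flip_e_diag -dflip_basis -!dflip_mul.
  by rewrite fe1 fe2 dflip0.
have [fv1 fv2] := fv i; rewrite -flip_v_diag -dflip_basis -!dflip_mul.
by rewrite fv1 fv2.
Qed.

(** Left multiplication by [g] scales both [f] and [g] by [through_sum g]; as [g] is a nonzero
    idempotent, this scalar is one. *)
Lemma jones_wenzl_mul f g : is_jones_wenzl f -> is_jones_wenzl g ->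
  dmul delta g f = f.
Proof.
have mulE u h : is_jones_wenzl u -> dmul delta h u = [ffun Z => through_sum h * u Z].
  move=> [_ [_ [ue uv]]].
  by apply: left_absorb_mul => i; [case: (ue i)|case: (uv i)].
move=> fJ gJ; suff g1 : through_sum g = 1.
  by rewrite mulE //; apply/ffunP => Z; rewrite ffunE g1 mul1r.
have [g0 [gg _]] := gJ.
apply/eqP/negPn/negP => g1; apply: g0; apply/ffunP => Z; rewrite [RHS]ffunE.
move/ffunP/(_ Z): gg; rewrite mulE // ffunE => /eqP.
rewrite -[X in _ == X]mul1r -subr_eq0 -mulrBl mulf_eq0.
by rewrite subr_eq0 (negbTE g1) => /eqP.
Qed.

Lemma is_jones_wenzl_jw : is_jones_wenzl jw.
Proof.
split; first exact: jw_neq0.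
split.
  rewrite left_absorb_mul; [|exact: jw_e|exact: jw_v].
  by apply/ffunP => Z; rewrite ffunE jw_sum mul1r.
(* The right-hand relations are reflections of the left-hand ones, because [jw] is its own
   reflection. *)
split=> i; split; [|exact: jw_e| |exact: jw_v].
  by rewrite -jw_flip -flip_e_diag -dflip_basis -dflip_mul jw_e dflip0.
by rewrite -{1}jw_flip -flip_v_diag -dflip_basis -dflip_mul jw_v jw_flip.
Qed.

(** The product of [jw] with a solution [g] equals [g], and applying the same fact to the
    reflections shows that it equals [jw]. *)
Lemma jones_wenzl_exists_unique : exists! f, is_jones_wenzl f.
Proof.
exists jw; split=> [|g gJ]; first exact: is_jones_wenzl_jw.
have jwJ := is_jones_wenzl_jw.
have := jones_wenzl_mul (is_jones_wenzl_flip jwJ) (is_jones_wenzl_flip gJ).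
by rewrite -dflip_mul (jones_wenzl_mul gJ jwJ) => /(inv_inj (@dflipK F n)).
Qed.

End JonesWenzl.

(** * The virtual Temperley-Lieb algebra *)

Section VirtualTemperleyLieb.

Variables (R : realType) (n : nat).
Implicit Types (f g : VTL R n) (X Y Z : diagram n).

(** The sum is the image of a polynomial of degree one. *)
Lemma d_addn_neq0 m : d R + m%:R != 0.
Proof.
have -> : d R + m%:R = tofrac ('X + m%:R%:P : {poly R[i]}).
  by rewrite tofracD polyC_natr rmorph_nat.
by rewrite tofrac_eq0 -size_poly_eq0 size_XaddC.
Qed.

Lemma K_natr_eq0 m : (m%:R == 0 :> K R) = (m == 0%N).
Proof.
have -> : m%:R = tofrac (m%:R%:P : {poly R[i]}) by rewrite polyC_natr rmorph_nat.
by rewrite tofrac_eq0 polyC_eq0 pnatr_eq0.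
Qed.

Lemma vtl_sumE (I : finType) (G : I -> VTL R n) Z :
  (\sum_i G i) Z = \sum_i (G i Z : K R).
Proof. by elim/big_rec2: _ => [|i y x _ <-]; rewrite ffunE. Qed.

Lemma vtl_mulE f g : vtl_mul f g = dmul (d R) f g.
Proof.
apply/ffunP => Z; rewrite [RHS]ffunE /vtl_mul vtl_sumE.
apply: eq_bigr => X _; rewrite vtl_sumE; apply: eq_bigr => Y _.
(* Scaling in [K^o] is multiplication in the field, so the two sides are convertible. *)
rewrite ffunE [vtl_diag _ _ _]ffunE; reflexivity.
Qed.

Lemma vtl0E : 0 = dzero (K R) n :> VTL R n.
Proof. by apply/ffunP => Z; rewrite !ffunE. Qed.

End VirtualTemperleyLieb.

Theorem proposition2p8 (R : realType) (n : nat) (hn : (1 <= n)%N) :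
  exists! f : VTL R n,
    f <> 0 /\
    vtl_mul f f = f /\
    (forall i : 'I_n.-1,
       vtl_mul f (vtl_e R i) = 0 /\ vtl_mul (vtl_e R i) f = 0) /\
    (forall i : 'I_n.-1,
       vtl_mul f (vtl_v R i) = f /\ vtl_mul (vtl_v R i) f = f).
Proof.
have [f [fJ fU]] := jones_wenzl_exists_unique n (K_natr_eq0 R) (d_addn_neq0 R).
(* Up to [vtl_mulE] and [vtl0E], the two systems of conditions coincide. *)
have jwE (g : VTL R n) : is_jones_wenzl (d R) g <->
    (g <> 0 /\ vtl_mul g g = g /\
    (forall i : 'I_n.-1,
       vtl_mul g (vtl_e R i) = 0 /\ vtl_mul (vtl_e R i) g = 0) /\
    (forall i : 'I_n.-1,
       vtl_mul g (vtl_v R i) = g /\ vtl_mul (vtl_v R i) g = g)).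
  rewrite vtl0E vtl_mulE; split=> -[g0 [gg [ge gv]]]; split=> //; split=> //; split=> i.
  - by have := ge i; rewrite -!vtl_mulE.
  - by have := gv i; rewrite -!vtl_mulE.
  - by have := ge i; rewrite !vtl_mulE.
  - by have := gv i; rewrite !vtl_mulE.
exists f; split=> [|g /jwE]; first exact/jwE.
exact: fU.
Qed.
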